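(* For a positive integer $i$, let $$f_i(x)=\psi^{(i)}(x+1)-x\psi^{(i+1)}\biggl(1+\frac{x}2\biggr),\qquad x\in(-1,\infty).$$ If $i$ is odd, then $f_i$ is strictly decreasing on $(-1,\infty)$; if $i$ is even, then $f_i$ is strictly increasing on $(-1,\infty)$. Moreover, for all positive integers $i$, $$\lim_{x\to-1^+}f_i(x)=(-1)^{i+1}\infty\quad\text{and}\quad \lim_{x\to\infty}f_i(x)=0.$$
   Context: $\Gamma$ is Euler's gamma function, $\psi(x)=\Gamma'(x)/\Gamma(x)$ is the psi (digamma) function, and $\psi^{(i)}$ denotes its $i$-th derivative (the polygamma functions). The notation $(-1)^{i+1}\infty$ means $+\infty$ if $i$ is odd and $-\infty$ if $i$ is even. *)

(* Defs.v *)
From Stdlib Require Import Reals.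
From Coquelicot Require Export Coquelicot.
Open Scope R_scope.

(* Euler's integral of the second kind, improper at both ends.  It converges
   exactly for x > 0; elsewhere the value is meaningless.  Derivatives are local,
   so [psi] and [polygamma] on (0, +oo) depend only on Gamma on (0, +oo). *)
Definition Gamma (x : R) : R :=
  RInt_gen (fun t : R => Rpower t (x - 1) * exp (- t))
    (at_right 0) (Rbar_locally p_infty).

Definition psi (x : R) : R := Derive Gamma x / Gamma x.

Definition polygamma (i : nat) (x : R) : R := Derive_n psi i x.

(* For x > -1 both arguments, x + 1 and 1 + x / 2, are positive. *)
Definition f_ (i : nat) (x : R) : R :=
  polygamma i (x + 1) - x * polygamma (S i) (1 + x / 2).

(* Main.v *)
Require Import Defs.
From Stdlib Require Import Reals Factorial Lra Lia.
From Coquelicot Require Import Coquelicot.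
Open Scope R_scope.

(** For x > 0 and j >= 0 write T_j(x) = (j+1)! * sum_k 1/(x+k)^(j+2); this is
    the absolute value of the polygamma function of order j+1, and
    polygamma (j+1) = (-1)^j T_j with T_j' = - T_(j+1).  Hence, for i = j+1,
    f_i = (-1)^j F_j with F_j(x) = T_j(x+1) + x T_(j+1)(1 + x/2), and all claims
    are claims about F_j.  The derivative of F_j is
      - [ T_(j+1)(1+x) - T_(j+1)(1+x/2) - (x/2) T_(j+1)'(1+x/2) ],
    which is minus the gap between the strictly convex function T_(j+1) at 1+x
    and its tangent at 1+x/2 ([abs_polygamma_tangent]).  It is negative except at
    x = 0, so F_j is strictly decreasing ([abs_f_decr]).  Near -1 the first term
    of the series makes F_j at least 1/(x+1) minus a constant ([abs_f_lower]), and
    telescoping bounds the series so that 0 < F_j(x) <= C/x for large x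
    ([abs_f_upper]).

    The substance is the series for the polygamma functions, starting from the
    integral that defines Gamma.  As in the Bohr-Mollerup theorem, the functional
    equation ([Gamma_succ]) and log-convexity ([lnGamma_convex]) suffice:
    convexity traps the slope of ln Gamma between y+n and x+n at ln n + o(1), and
    the functional equation transports this to the slope between y and x.  The
    outcome ([lnGamma_pinched]) is that, for x < y,
      D(x) <= (ln Gamma(y) - ln Gamma(x)) / (y - x) <= D(y),
    where D is the digamma series.  Such two-sided slope bounds
    ([slope_pinched]) also replace uniform convergence.  They can be summed term
    by term, they force F to be continuous, and together with continuity of the
    bounding function G they give F' = G.  Each sum of inverse powers is pinched
    by the one with exponent one higher, so all the derivatives follow from a
    single mechanism. *)

(** * Improper integrals over (0, +oo) *)

Definition is_RInt_halfline (f : R -> R) (l : R) : Prop :=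
  is_RInt_gen f (at_right 0) (Rbar_locally p_infty) l.

(** The filter statement is made concrete by choosing end points; keeping them on
    either side of [1, 2] guarantees a < b. *)
Lemma is_RInt_halfline_approx f l (eps : R) :
  is_RInt_halfline f l -> 0 < eps ->
  exists a b, 0 < a <= 1 /\ 2 <= b /\
    exists v, is_RInt f a b v /\ Rabs (v - l) < eps.
Proof.
intros Hf Heps.
assert (H : filter_prod (at_right 0) (Rbar_locally p_infty)
  (fun ab => exists v, is_RInt f (fst ab) (snd ab) v /\ Rabs (v - l) < eps)).
{ apply (Hf (fun v => Rabs (v - l) < eps)).
  exists (mkposreal eps Heps). intros v Hv. exact Hv. }
destruct H as [P Q [d Hd] [M HM] H].
exists (Rmin (d / 2) 1), (Rmax (M + 1) 2).
pose proof (cond_pos d) as Hd0.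
assert (0 < Rmin (d / 2) 1) by (apply Rmin_pos; lra).
split; [split; [assumption | apply Rmin_r]|].
split; [apply Rmax_r|].
apply (H (Rmin (d / 2) 1) (Rmax (M + 1) 2)).
- apply Hd; [|assumption].
  change (Rabs (Rmin (d / 2) 1 - 0) < d).
  rewrite Rminus_0_r, Rabs_pos_eq by lra.
  pose proof (Rmin_l (d / 2) 1). lra.
- apply HM. pose proof (Rmax_l (M + 1) 2). lra.
Qed.

Lemma is_RInt_halfline_scal k f l :
  is_RInt_halfline f l -> is_RInt_halfline (fun t => k * f t) (k * l).
Proof. exact (is_RInt_gen_scal f k l). Qed.

Lemma is_RInt_halfline_plus f g lf lg : is_RInt_halfline f lf -> is_RInt_halfline g lg ->
  is_RInt_halfline (fun t => f t + g t) (lf + lg).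
Proof. exact (is_RInt_gen_plus f g lf lg). Qed.

Lemma is_RInt_halfline_minus f g lf lg : is_RInt_halfline f lf -> is_RInt_halfline g lg ->
  is_RInt_halfline (fun t => f t - g t) (lf - lg).
Proof. exact (is_RInt_gen_minus f g lf lg). Qed.

Lemma is_RInt_halfline_ge0 f l :
  is_RInt_halfline f l -> (forall t, 0 < t -> 0 <= f t) -> 0 <= l.
Proof.
intros Hf Hpos. destruct (Rle_lt_dec 0 l) as [|Hl]; [assumption|exfalso].
destruct (is_RInt_halfline_approx f l (- l) Hf ltac:(lra))
  as (a & b & Ha & Hb & v & Hv & Habs).
assert (0 <= v).
{ rewrite <- (is_RInt_unique _ _ _ _ Hv).
  apply RInt_ge_0; [lra|now exists v|]. intros t Ht. apply Hpos. lra. }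
apply Rabs_def2 in Habs. lra.
Qed.

Lemma is_RInt_halfline_le f g lf lg :
  is_RInt_halfline f lf -> is_RInt_halfline g lg ->
  (forall t, 0 < t -> f t <= g t) -> lf <= lg.
Proof.
intros Hf Hg Hle.
pose proof (is_RInt_halfline_minus _ _ _ _ Hg Hf) as H.
apply is_RInt_halfline_ge0 in H; [lra|].
intros t Ht. specialize (Hle t Ht). lra.
Qed.

Lemma is_RInt_halfline_unique f l1 l2 :
  is_RInt_halfline f l1 -> is_RInt_halfline f l2 -> l1 = l2.
Proof.
intros H1 H2.
apply Rle_antisym; [apply (is_RInt_halfline_le f f)|apply (is_RInt_halfline_le f f)];
  auto using Rle_refl.
Qed.

Lemma ex_RInt_continuous_pos (f : R -> R) a b :
  (forall t, 0 < t -> continuous f t) -> 0 < a -> a <= b -> ex_RInt f a b.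
Proof.
intros Hc Ha Hab. apply (ex_RInt_continuous (V := R_CompleteNormedModule)).
intros z Hz. apply Hc. rewrite Rmin_left in Hz by lra. lra.
Qed.

(** Comparison test in terms of a primitive: since f <= g = G', the integral of f
    over [a, b] is at most G b - G a <= M.  The integrals of f >= 0 grow with the
    interval, so they converge to their supremum, which also bounds them.  A single
    bounded primitive on (0, +oo) deals with both improper ends at once. *)
Lemma is_RInt_halfline_dominated (f g G : R -> R) M :
  (forall t, 0 < t -> continuous f t) ->
  (forall t, 0 < t -> 0 <= f t <= g t) ->
  (forall t, 0 < t -> continuous g t) ->
  (forall t, 0 < t -> is_derive G t (g t)) ->
  (forall t, 0 < t -> 0 <= G t <= M) ->
  exists l, is_RInt_halfline f l /\
    (forall a b, 0 < a -> a <= b -> RInt f a b <= l).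
Proof.
intros Hfc Hfg Hgc HG HM.
assert (Hbound : forall a b, 0 < a -> a <= b -> RInt f a b <= M).
{ intros a b Ha Hab.
  assert (Hg : is_RInt g a b (minus (G b) (G a))).
  { apply (is_RInt_derive G g); rewrite Rmin_left, Rmax_right by lra;
      intros t Ht; [apply HG | apply Hgc]; lra. }
  apply Rle_trans with (RInt g a b).
  - apply RInt_le; try assumption; try (now apply ex_RInt_continuous_pos).
    intros t Ht. apply Hfg. lra.
  - rewrite (is_RInt_unique _ _ _ _ Hg).
    unfold minus, plus, opp; simpl.
    pose proof (HM a Ha). pose proof (HM b ltac:(lra)). lra. }
assert (Hmono : forall a b c d, 0 < a -> a <= b -> b <= c -> c <= d ->
  RInt f b c <= RInt f a d).
{ intros a b c d Ha Hab Hbc Hcd.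
  assert (Hex : forall u v, 0 < u -> u <= v -> ex_RInt f u v)
    by (intros; now apply ex_RInt_continuous_pos).
  rewrite <- (RInt_Chasles f a b d) by (apply Hex; lra).
  rewrite <- (RInt_Chasles f b c d) by (apply Hex; lra).
  unfold plus; simpl.
  assert (0 <= RInt f a b) by
    (apply RInt_ge_0; [lra|apply Hex; lra|intros t Ht; apply Hfg; lra]).
  assert (0 <= RInt f c d) by
    (apply RInt_ge_0; [lra|apply Hex; lra|intros t Ht; apply Hfg; lra]).
  lra. }
destruct (completeness (fun v => exists a b, 0 < a /\ a <= b /\ v = RInt f a b))
  as [l [Hub Hlub]].
{ exists M. intros v (a & b & Ha & Hab & ->). now apply Hbound. }
{ exists (RInt f 1 1), 1, 1. repeat split; lra. }
assert (Hle : forall a b, 0 < a -> a <= b -> RInt f a b <= l).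
{ intros a b Ha Hab. apply Hub. now exists a, b. }
exists l. split; [|exact Hle].
intros P [eps HP].
assert (Hnear : exists a b, 0 < a /\ a <= b /\ l - eps < RInt f a b).
{ destruct (Classical_Prop.classic
    (exists a b, 0 < a /\ a <= b /\ l - eps < RInt f a b)) as [|Hno]; [assumption|].
  exfalso. pose proof (cond_pos eps).
  assert (l <= l - eps); [|lra].
  apply Hlub. intros v (a & b & Ha & Hab & ->).
  apply Rnot_lt_le. intros Hlt. apply Hno. now exists a, b. }
destruct Hnear as (a0 & b0 & Ha0 & Hab0 & Hnear).
apply Filter_prod with (fun a => 0 < a < a0) (fun b => b0 < b).
- exists (mkposreal a0 Ha0). intros a Ha Hapos.
  change (Rabs (a - 0) < a0) in Ha.
  rewrite Rminus_0_r, Rabs_pos_eq in Ha by lra. lra.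
- now exists b0.
- intros a b Ha Hb. exists (RInt f a b). split.
  + apply (RInt_correct (V := R_CompleteNormedModule)).
    apply ex_RInt_continuous_pos; [assumption|simpl; lra|simpl; lra].
  + apply HP. change (Rabs (RInt f a b - l) < eps).
    pose proof (Hle a b ltac:(lra) ltac:(lra)).
    pose proof (Hmono a a0 b0 b ltac:(lra) ltac:(lra) ltac:(lra) ltac:(lra)).
    apply Rabs_def1; lra.
Qed.

(** * Gamma: convergence, functional equation, logarithmic convexity *)

Lemma exp_nondecreasing u v : u <= v -> exp u <= exp v.
Proof.
intros [H| ->]; [now apply Rlt_le, exp_increasing|apply Rle_refl].
Qed.

(** The tangent line of c ln at u = c. *)
Lemma ln_le_linear c u : 0 < c -> 0 < u -> c * ln u <= u + c * (ln c - 1).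
Proof.
intros Hc Hu.
assert (H : ln (u / c) <= u / c - 1).
{ pose proof (exp_ineq1_le (ln (u / c))) as He.
  rewrite exp_ln in He by (now apply Rdiv_lt_0_compat). lra. }
rewrite ln_div in H by assumption.
apply Rmult_le_compat_l with (r := c) in H; [|lra].
replace (c * (u / c - 1)) with (u - c) in H by (field; lra). lra.
Qed.

Definition kernel (x t : R) : R := Rpower t (x - 1) * exp (- t).

Lemma kernel_continuous x t : 0 < t -> continuous (kernel x) t.
Proof.
intros Ht. apply (ex_derive_continuous (kernel x)).
unfold kernel, Rpower. auto_derive. lra.
Qed.

Lemma kernel_pos x t : 0 < kernel x t.
Proof. unfold kernel, Rpower. apply Rmult_lt_0_compat; apply exp_pos. Qed.

(** The comparison primitive is a multiple of (t/(1+t))^x, which stays in [0, 1]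
    and has derivative x t^(x-1) (1+t)^(-x-1).  It dominates t^(x-1) exp(-t)
    because (1+t)^(x+1) exp(-t) is bounded, by the tangent line of ln at x+1. *)
Lemma kernel_integrable x : 0 < x ->
  exists l, is_RInt_halfline (kernel x) l /\
    (forall a b, 0 < a -> a <= b -> RInt (kernel x) a b <= l).
Proof.
intros Hx.
set (C := exp (1 + (x + 1) * (ln (x + 1) - 1)) / x).
assert (HC : 0 < C) by (apply Rdiv_lt_0_compat; [apply exp_pos|lra]).
set (w := fun t => exp (x * (ln t - ln (1 + t)))).
apply (is_RInt_halfline_dominated (kernel x)
  (fun t => C * (x * exp ((x - 1) * ln t - (x + 1) * ln (1 + t))))
  (fun t => C * w t) C).
- intros t Ht. now apply kernel_continuous.
- intros t Ht. split; [apply Rlt_le, kernel_pos|].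
  unfold C.
  replace (exp (1 + (x + 1) * (ln (x + 1) - 1)) / x *
    (x * exp ((x - 1) * ln t - (x + 1) * ln (1 + t))))
    with (exp (1 + (x + 1) * (ln (x + 1) - 1)) *
          exp ((x - 1) * ln t - (x + 1) * ln (1 + t))) by (field; lra).
  unfold kernel, Rpower. rewrite <- !exp_plus.
  apply exp_nondecreasing.
  pose proof (ln_le_linear (x + 1) (1 + t) ltac:(lra) ltac:(lra)). lra.
- intros t Ht.
  apply (ex_derive_continuous (fun t => C * (x * exp ((x - 1) * ln t - (x + 1) * ln (1 + t))))).
  auto_derive. lra.
- intros t Ht. unfold w. auto_derive; [lra|].
  replace ((x - 1) * ln t - (x + 1) * ln (1 + t))
    with (x * (ln t - ln (1 + t)) - ln t - ln (1 + t)) by ring.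
  unfold Rminus. rewrite !exp_plus, !exp_Ropp, !exp_ln by lra.
  field. lra.
- intros t Ht. split.
  + apply Rlt_le, Rmult_lt_0_compat; [assumption|apply exp_pos].
  + rewrite <- (Rmult_1_r C) at 2. apply Rmult_le_compat_l; [lra|].
    unfold w. apply Rle_trans with (exp 0); [apply exp_nondecreasing|rewrite exp_0; lra].
    assert (ln t <= ln (1 + t)) by (apply Rlt_le, ln_increasing; lra).
    nra.
Qed.

Lemma Gamma_unique x l : is_RInt_halfline (kernel x) l -> Gamma x = l.
Proof.
intros H. exact (is_RInt_gen_unique (V := R_CompleteNormedModule) (kernel x) l H).
Qed.

Lemma Gamma_is_RInt x : 0 < x -> is_RInt_halfline (kernel x) (Gamma x).
Proof.
intros Hx. destruct (kernel_integrable x Hx) as (l & Hl & _).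
now rewrite (Gamma_unique x l Hl).
Qed.

Lemma Gamma_pos x : 0 < x -> 0 < Gamma x.
Proof.
intros Hx. destruct (kernel_integrable x Hx) as (l & Hl & Hle).
rewrite (Gamma_unique x l Hl).
apply Rlt_le_trans with (RInt (kernel x) 1 2); [|apply Hle; lra].
apply RInt_gt_0; [lra|intros; apply kernel_pos|].
intros t Ht. apply kernel_continuous. lra.
Qed.

Definition lnGamma (x : R) : R := ln (Gamma x).

Lemma kernel_succ_vanishes_0 x : 0 < x ->
  filterlim (kernel (x + 1)) (at_right 0) (locally 0).
Proof.
intros Hx P [eps HP].
(* t^x < eps as soon as t < eps^(1/x). *)
exists (mkposreal _ (exp_pos (ln eps / x))). intros t Ht Htpos.
change (Rabs (t - 0) < exp (ln eps / x)) in Ht.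
rewrite Rminus_0_r, Rabs_pos_eq in Ht by lra.
apply HP. change (Rabs (kernel (x + 1) t - 0) < eps).
pose proof (kernel_pos (x + 1) t).
rewrite Rminus_0_r, Rabs_pos_eq by lra.
unfold kernel, Rpower. rewrite <- exp_plus.
rewrite <- (exp_ln eps) by apply cond_pos. apply exp_increasing.
apply ln_increasing in Ht; [|assumption]. rewrite ln_exp in Ht.
apply Rmult_lt_compat_l with (r := x) in Ht; [|assumption].
replace (x * (ln eps / x)) with (ln eps) in Ht by (field; lra). lra.
Qed.

Lemma kernel_succ_vanishes_infty x : 0 < x ->
  filterlim (kernel (x + 1)) (Rbar_locally p_infty) (locally 0).
Proof.
intros Hx P [eps HP].
(* K bounds t^(x+1) exp(-t), so t^x exp(-t) <= K / t. *)
set (K := exp ((x + 1) * (ln (x + 1) - 1))).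
assert (HK : 0 < K) by apply exp_pos.
pose proof (cond_pos eps) as Heps.
exists (K / eps). intros t Ht.
assert (Htpos : 0 < t).
{ apply Rlt_trans with (2 := Ht). now apply Rdiv_lt_0_compat. }
apply HP. change (Rabs (kernel (x + 1) t - 0) < eps).
pose proof (kernel_pos (x + 1) t).
rewrite Rminus_0_r, Rabs_pos_eq by lra.
assert (Hb : t * kernel (x + 1) t <= K).
{ unfold kernel, Rpower, K. rewrite <- (exp_ln t) at 1 by assumption.
  rewrite <- !exp_plus. apply exp_nondecreasing.
  pose proof (ln_le_linear (x + 1) t ltac:(lra) Htpos). lra. }
apply Rmult_lt_reg_l with t; [assumption|].
apply Rle_lt_trans with (1 := Hb).
apply Rmult_lt_compat_r with (r := eps) in Ht; [|assumption].
replace (K / eps * eps) with K in Ht by (field; lra). assumption.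
Qed.

Lemma kernel_succ_derive x t : 0 < t ->
  is_derive (kernel (x + 1)) t (x * kernel x t - kernel (x + 1) t).
Proof.
intros Ht. unfold kernel, Rpower. auto_derive; [lra|].
replace ((x + 1 - 1) * ln t) with ((x - 1) * ln t + ln t) by ring.
rewrite exp_plus, exp_ln by lra. field. lra.
Qed.

(** Integration by parts: x t^(x-1) exp(-t) - t^x exp(-t) is the derivative of
    t^x exp(-t), which vanishes at both ends. *)
Lemma Gamma_succ x : 0 < x -> Gamma (x + 1) = x * Gamma x.
Proof.
intros Hx.
assert (Hev : filter_prod (at_right 0) (Rbar_locally p_infty)
  (fun ab : R * R => 0 < Rmin (fst ab) (snd ab))).
{ apply Filter_prod with (fun a => 0 < a) (fun b => 0 < b).
  - now exists (mkposreal 1 Rlt_0_1).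
  - now exists 0.
  - intros a b Ha Hb. now apply Rmin_pos. }
assert (HD : is_RInt_halfline (Derive (kernel (x + 1))) (0 - 0)).
{ apply (is_RInt_gen_Derive (kernel (x + 1)) 0 0).
  - apply filter_imp with (2 := Hev). intros [a b] H t Ht. simpl in *.
    eexists. apply kernel_succ_derive. lra.
  - apply filter_imp with (2 := Hev). intros [a b] H t Ht. simpl in *.
    assert (Htpos : 0 < t) by lra.
    apply (continuous_ext_loc _ (fun t => x * kernel x t - kernel (x + 1) t)).
    + exists (mkposreal t Htpos). intros s Hs.
      change (Rabs (s - t) < t) in Hs. apply Rabs_def2 in Hs.
      symmetry. apply is_derive_unique, kernel_succ_derive. lra.
    + apply (continuous_minus (V := R_NormedModule) (fun t => x * kernel x t) (kernel (x + 1))).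
      * apply (continuous_scal_r (V := R_NormedModule) x (kernel x)).
        now apply kernel_continuous.
      * now apply kernel_continuous.
  - now apply kernel_succ_vanishes_0.
  - now apply kernel_succ_vanishes_infty. }
pose proof (is_RInt_halfline_minus _ _ _ _
  (is_RInt_halfline_scal x _ _ (Gamma_is_RInt x Hx))
  (Gamma_is_RInt (x + 1) ltac:(lra))) as HM.
assert (HD' : is_RInt_halfline
  (fun t => x * kernel x t - kernel (x + 1) t) (0 - 0)).
{ apply (is_RInt_gen_ext (Derive (kernel (x + 1)))
    (fun t => x * kernel x t - kernel (x + 1) t) (0 - 0)); [|exact HD].
  apply filter_imp with (2 := Hev). intros [a b] H t Ht. simpl in *.
  apply is_derive_unique, kernel_succ_derive. lra. }
pose proof (is_RInt_halfline_unique _ _ _ HM HD') as H2. lra.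
Qed.

Lemma lnGamma_succ x : 0 < x -> lnGamma (x + 1) = lnGamma x + ln x.
Proof.
intros Hx. unfold lnGamma. rewrite Gamma_succ by assumption.
rewrite ln_mult; [ring|assumption|now apply Gamma_pos].
Qed.

(** Both values of exp lie above the tangent line at the intermediate point. *)
Lemma exp_convex l u v : 0 <= l <= 1 ->
  exp (l * u + (1 - l) * v) <= l * exp u + (1 - l) * exp v.
Proof.
intros Hl. set (w := l * u + (1 - l) * v).
assert (Htan : forall z, exp w * (1 + (z - w)) <= exp z).
{ intros z. replace (exp z) with (exp w * exp (z - w))
    by (rewrite <- exp_plus; f_equal; ring).
  apply Rmult_le_compat_l; [apply Rlt_le, exp_pos|apply exp_ineq1_le]. }
pose proof (Htan u) as Hu. pose proof (Htan v) as Hv.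
apply Rmult_le_compat_l with (r := l) in Hu; [|lra].
apply Rmult_le_compat_l with (r := 1 - l) in Hv; [|lra].
assert (exp w = l * (exp w * (1 + (u - w))) + (1 - l) * (exp w * (1 + (v - w))))
  by (unfold w; ring).
lra.
Qed.

(** Hoelder's inequality, proved directly: convexity of exp, applied pointwise
    to the integrands normalised by Gamma x and Gamma z, bounds the normalised
    integrand at the intermediate point by an average whose integral is
    l + (1 - l) = 1. *)
Lemma lnGamma_convex l x z : 0 <= l <= 1 -> 0 < x -> 0 < z ->
  lnGamma (l * x + (1 - l) * z) <= l * lnGamma x + (1 - l) * lnGamma z.
Proof.
intros Hl Hx Hz.
set (y := l * x + (1 - l) * z).
assert (Hy : 0 < y).
{ unfold y. destruct (Rle_lt_dec l (1/2)); nra. }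
pose proof (Gamma_pos x Hx) as Gx. pose proof (Gamma_pos y Hy) as Gy.
pose proof (Gamma_pos z Hz) as Gz.
set (c := l * lnGamma x + (1 - l) * lnGamma z).
assert (H : exp (- c) * Gamma y <= l * / Gamma x * Gamma x + (1 - l) * / Gamma z * Gamma z).
{ apply (is_RInt_halfline_le
    (fun t => exp (- c) * kernel y t)
    (fun t => l * / Gamma x * kernel x t + (1 - l) * / Gamma z * kernel z t)).
  - now apply is_RInt_halfline_scal, Gamma_is_RInt.
  - now apply is_RInt_halfline_plus; apply is_RInt_halfline_scal, Gamma_is_RInt.
  - intros t Ht.
    unfold kernel, Rpower.
    pose proof (exp_convex l ((x - 1) * ln t - lnGamma x)
                             ((z - 1) * ln t - lnGamma z) Hl) as He.
    replace (l * ((x - 1) * ln t - lnGamma x) + (1 - l) * ((z - 1) * ln t - lnGamma z))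
      with (- c + (y - 1) * ln t) in He by (unfold c, y; ring).
    unfold Rminus in He at 2 4.
    rewrite exp_plus in He.
    replace (l * exp ((x - 1) * ln t + - lnGamma x))
      with (l * (exp ((x - 1) * ln t) * / Gamma x)) in He
      by (rewrite exp_plus, exp_Ropp; unfold lnGamma; now rewrite exp_ln).
    replace (exp ((z - 1) * ln t - lnGamma z))
      with ((exp ((z - 1) * ln t) * / Gamma z)) in He
      by (unfold Rminus at 2; rewrite exp_plus, exp_Ropp; unfold lnGamma; now rewrite exp_ln).
    apply Rmult_le_compat_r with (r := exp (- t)) in He; [|apply Rlt_le, exp_pos].
    lra. }
replace (l * / Gamma x * Gamma x + (1 - l) * / Gamma z * Gamma z) with 1 in H
  by (field; lra).
unfold lnGamma at 1. rewrite <- (ln_exp c).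
apply ln_le; [assumption|].
rewrite exp_Ropp in H.
apply Rmult_le_compat_l with (r := exp c) in H; [|apply Rlt_le, exp_pos].
rewrite <- Rmult_assoc, Rinv_r, Rmult_1_l in H; [lra|].
apply Rgt_not_eq, exp_pos.
Qed.

Lemma lnGamma_slopes x y z : 0 < x -> x < y -> y < z ->
  (lnGamma y - lnGamma x) * (z - y) <= (lnGamma z - lnGamma y) * (y - x).
Proof.
intros Hx Hxy Hyz.
pose proof (lnGamma_convex ((z - y) / (z - x)) x z) as H.
assert (Hl : 0 <= (z - y) / (z - x) <= 1).
{ split; [apply Rcomplements.Rdiv_le_0_compat; lra|].
  apply Rcomplements.Rle_div_l; lra. }
specialize (H Hl Hx ltac:(lra)).
replace ((z - y) / (z - x) * x + (1 - (z - y) / (z - x)) * z) with y in H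
  by (field; lra).
apply Rmult_le_compat_l with (r := z - x) in H; [|lra].
replace ((z - x) * ((z - y) / (z - x) * lnGamma x + (1 - (z - y) / (z - x)) * lnGamma z))
  with ((z - y) * lnGamma x + (y - x) * lnGamma z) in H by (field; lra).
lra.
Qed.

(** * Functions whose slopes are bounded by values of another function *)

(** Equivalently, G x is a subgradient of F at every x > 0; such an F is convex. *)
Definition slope_pinched (F G : R -> R) : Prop :=
  forall x y, 0 < x -> x < y ->
    (y - x) * G x <= F y - F x <= (y - x) * G y.

Lemma slope_pinched_le F G x y :
  slope_pinched F G -> 0 < x -> x < y -> G x <= G y.
Proof.
intros HFG Hx Hxy. specialize (HFG x y Hx Hxy).
apply Rmult_le_reg_l with (y - x); lra.
Qed.

Lemma slope_pinched_of_derive F G :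
  (forall x, 0 < x -> is_derive F x (G x)) ->
  (forall x y, 0 < x -> x < y -> G x <= G y) ->
  slope_pinched F G.
Proof.
intros HF HG x y Hx Hxy.
destruct (MVT_cor2 F G x y Hxy) as (c & Hc & Hcxy).
{ intros c Hc. apply is_derive_Reals, HF. lra. }
pose proof (HG x c Hx ltac:(lra)). pose proof (HG c y ltac:(lra) ltac:(lra)).
rewrite Hc, (Rmult_comm (G c)).
split; apply Rmult_le_compat_l; lra.
Qed.

(** G is monotone, hence bounded near x, so F is Lipschitz there. *)
Lemma slope_pinched_continuous F G x :
  slope_pinched F G -> 0 < x -> continuous F x.
Proof.
intros HFG Hx.
set (K := Rabs (G (x / 2)) + Rabs (G (2 * x)) + 1).
pose proof (Rabs_pos (G (x / 2))). pose proof (Rabs_pos (G (2 * x))).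
assert (HK : 0 < K) by (unfold K; lra).
assert (HG : forall z, x / 2 < z < 2 * x -> - K <= G z <= K).
{ intros z Hz.
  pose proof (slope_pinched_le _ _ (x / 2) z HFG ltac:(lra) ltac:(lra)).
  pose proof (slope_pinched_le _ _ z (2 * x) HFG ltac:(lra) ltac:(lra)).
  pose proof (Rle_abs (G (2 * x))). pose proof (Rle_abs (- G (x / 2))) as Hn.
  rewrite Rabs_Ropp in Hn. unfold K; lra. }
assert (Hlip : forall y z, x / 2 < y -> y < z -> z < 2 * x ->
  - (K * (z - y)) <= F z - F y <= K * (z - y)).
{ intros y z Hy Hyz Hz. pose proof (HFG y z ltac:(lra) Hyz) as [H1 H2].
  pose proof (HG y ltac:(lra)). pose proof (HG z ltac:(lra)).
  split; [apply Rle_trans with (2 := H1)|apply Rle_trans with (1 := H2)]; nra. }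
intros P [eps HP]. pose proof (cond_pos eps) as Heps.
assert (Hd : 0 < Rmin (x / 2) (eps / K))
  by (apply Rmin_pos; [lra|now apply Rdiv_lt_0_compat]).
exists (mkposreal _ Hd). intros y Hy. apply HP.
change (Rabs (y - x) < Rmin (x / 2) (eps / K)) in Hy.
change (Rabs (F y - F x) < eps).
pose proof (Rmin_l (x / 2) (eps / K)). pose proof (Rmin_r (x / 2) (eps / K)).
assert (HKy : K * Rabs (y - x) < eps).
{ replace (pos eps) with (K * (eps / K)) by (field; lra).
  apply Rmult_lt_compat_l; lra. }
apply Rle_lt_trans with (2 := HKy).
assert (Hyx : Rabs (y - x) < x / 2) by lra. apply Rabs_def2 in Hyx.
destruct (Rtotal_order y x) as [Hlt|[->|Hgt]].
- pose proof (Hlip y x ltac:(lra) ltac:(lra) ltac:(lra)).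
  rewrite (Rabs_left (y - x)) by lra. apply Rabs_le. lra.
- rewrite !Rminus_diag, Rabs_R0. lra.
- pose proof (Hlip x y ltac:(lra) ltac:(lra) ltac:(lra)).
  rewrite (Rabs_pos_eq (y - x)) by lra. apply Rabs_le. lra.
Qed.

(** The difference quotient between x and x + h lies between G x and G (x + h). *)
Lemma slope_pinched_is_derive F G x :
  slope_pinched F G -> 0 < x -> continuous G x -> is_derive F x (G x).
Proof.
intros HFG Hx HG. apply is_derive_Reals. intros eps Heps.
destruct (HG (fun z => Rabs (z - G x) < eps)) as [d Hd].
{ exists (mkposreal eps Heps). intros z Hz. exact Hz. }
pose proof (cond_pos d) as Hd0.
assert (Hmin : 0 < Rmin d x) by now apply Rmin_pos.
exists (mkposreal _ Hmin). intros h Hh Hhd. simpl in Hhd.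
pose proof (Rmin_l d x). pose proof (Rmin_r d x).
assert (HGh : Rabs (G (x + h) - G x) < eps).
{ apply Hd. change (Rabs (x + h - x) < d). replace (x + h - x) with h by ring. lra. }
apply Rabs_def2 in HGh. apply Rabs_def2 in Hhd.
set (q := (F (x + h) - F x) / h).
assert (Hq : F (x + h) - F x = h * q) by (unfold q; field; assumption).
destruct (Rlt_or_le h 0) as [Hneg|Hpos].
- pose proof (HFG (x + h) x ltac:(lra) ltac:(lra)) as Hp.
  assert (G (x + h) <= q) by (apply Rmult_le_reg_l with (- h); lra).
  assert (q <= G x) by (apply Rmult_le_reg_l with (- h); lra).
  apply Rabs_def1; lra.
- pose proof (HFG x (x + h) ltac:(lra) ltac:(lra)) as Hp.
  assert (G x <= q) by (apply Rmult_le_reg_l with h; lra).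
  assert (q <= G (x + h)) by (apply Rmult_le_reg_l with h; lra).
  apply Rabs_def1; lra.
Qed.

Lemma Series_le_ex (a b : nat -> R) :
  (forall n, a n <= b n) -> ex_series a -> ex_series b -> Series a <= Series b.
Proof.
intros Hab Ha Hb.
apply (is_lim_seq_le (sum_n a) (sum_n b) (Series a) (Series b)).
- intros n. apply sum_n_m_le. exact Hab.
- exact (Series_correct a Ha).
- exact (Series_correct b Hb).
Qed.

Lemma sum_n_succ (a : nat -> R) n : sum_n a (S n) = sum_n a n + a (S n).
Proof. exact (sum_Sn a n). Qed.

(** Differentiation of a series term by term: the inequalities pass to the sums
    with pointwise convergence only. *)
Lemma slope_pinched_series (u v : nat -> R -> R) :
  (forall k, slope_pinched (u k) (v k)) ->
  (forall x, 0 < x -> ex_series (fun k => u k x)) ->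
  (forall x, 0 < x -> ex_series (fun k => v k x)) ->
  slope_pinched (fun x => Series (fun k => u k x)) (fun x => Series (fun k => v k x)).
Proof.
intros Huv Hu Hv x y Hx Hxy.
assert (Hy : 0 < y) by lra.
rewrite <- Series_minus by auto. rewrite <- !Series_scal_l.
assert (Hd : ex_series (fun k => u k y - u k x)) by
  (apply (ex_series_minus (V := R_NormedModule) (fun k => u k y) (fun k => u k x)); auto).
split; apply Series_le_ex; try assumption;
  try (apply (ex_series_scal (V := R_NormedModule) (y - x)); auto);
  intros k; now apply Huv.
Qed.

(** * Sums of inverse powers *)

(** The Hurwitz zeta function of exponent m. *)
Definition hurwitz (m : nat) (x : R) : R := Series (fun k => / (x + INR k) ^ m).

Lemma shift_pos x k : 0 < x -> 0 < x + INR k.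
Proof. intros Hx. pose proof (pos_INR k). lra. Qed.

Lemma is_lim_seq_inv_shift x : is_lim_seq (fun n => / (x + INR n)) 0.
Proof.
apply (is_lim_seq_inv (fun n => x + INR n) p_infty); [|easy].
apply (is_lim_seq_plus (fun _ => x) INR x p_infty p_infty);
  [apply is_lim_seq_const|apply is_lim_seq_INR|reflexivity].
Qed.

Lemma is_series_telescope x : 0 < x ->
  is_series (fun k => / (x + INR k) - / (x + 1 + INR k)) (/ x).
Proof.
intros Hx.
change (is_lim_seq (sum_n (fun k => / (x + INR k) - / (x + 1 + INR k))) (/ x)).
apply (is_lim_seq_ext (fun n => / x - / (x + 1 + INR n))).
- intros n. induction n as [|n IH].
  + rewrite sum_O. simpl. now rewrite !Rplus_0_r.
  + rewrite sum_n_succ, <- IH.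
    rewrite S_INR. replace (x + (INR n + 1)) with (x + 1 + INR n) by ring. ring.
- replace (Finite (/ x)) with (Finite (/ x - 0)) by (f_equal; ring).
  apply is_lim_seq_minus'; [apply is_lim_seq_const|apply is_lim_seq_inv_shift].
Qed.

Lemma inv_sqr_le_telescope z : 0 < z -> / (z + 1) ^ 2 <= / z - / (z + 1).
Proof.
intros Hz. replace (/ z - / (z + 1)) with (/ (z * (z + 1))) by (field; lra).
apply Rinv_le_contravar; nra.
Qed.

Lemma ex_series_hurwitz_2_succ x : 0 < x ->
  ex_series (fun k => / (x + 1 + INR k) ^ 2).
Proof.
intros Hx.
apply (ex_series_le (V := R_CompleteNormedModule) _
  (fun k => / (x + INR k) - / (x + 1 + INR k))).
- intros k. pose proof (shift_pos x k Hx).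
  change (Rabs (/ (x + 1 + INR k) ^ 2) <= / (x + INR k) - / (x + 1 + INR k)).
  rewrite Rabs_pos_eq by (apply Rlt_le, Rinv_0_lt_compat, pow_lt; lra).
  replace (x + 1 + INR k) with (x + INR k + 1) by ring.
  now apply inv_sqr_le_telescope.
- eexists. now apply is_series_telescope.
Qed.

(** Exponent 2 converges by comparison with a telescoping series; larger exponents
    only gain bounded factors. *)
Lemma ex_series_hurwitz m x : (2 <= m)%nat -> 0 < x ->
  ex_series (fun k => / (x + INR k) ^ m).
Proof.
intros Hm Hx.
assert (H2 : ex_series (fun k => / (x + INR k) ^ 2)).
{ apply ex_series_incr_1.
  apply ex_series_ext with (2 := ex_series_hurwitz_2_succ x Hx).
  intros k. rewrite S_INR. now replace (x + (INR k + 1)) with (x + 1 + INR k) by ring. }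
apply (ex_series_le (V := R_CompleteNormedModule) _
  (fun k => / x ^ (m - 2) * / (x + INR k) ^ 2)).
- intros k. pose proof (shift_pos x k Hx). pose proof (pos_INR k).
  change (Rabs (/ (x + INR k) ^ m) <= / x ^ (m - 2) * / (x + INR k) ^ 2).
  rewrite Rabs_pos_eq by (apply Rlt_le, Rinv_0_lt_compat, pow_lt; lra).
  replace m with (m - 2 + 2)%nat at 1 by lia.
  rewrite pow_add, Rinv_mult.
  apply Rmult_le_compat_r; [apply Rlt_le, Rinv_0_lt_compat, pow_lt; lra|].
  apply Rinv_le_contravar; [now apply pow_lt|apply pow_incr; lra].
- now apply (ex_series_scal (V := R_NormedModule) (/ x ^ (m - 2))).
Qed.

Lemma hurwitz_ge_first_term m x : (2 <= m)%nat -> 0 < x -> / x ^ m <= hurwitz m x.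
Proof.
intros Hm Hx. pose proof (ex_series_hurwitz m x Hm Hx) as Hex.
unfold hurwitz. rewrite Series_incr_1 by assumption.
change (INR 0) with 0. rewrite Rplus_0_r.
assert (0 <= Series (fun k => / (x + INR (S k)) ^ m)); [|lra].
rewrite <- (Rmult_0_l (Series (fun k => / (x + INR (S k)) ^ m))) at 1.
rewrite <- Series_scal_l. apply Series_le_ex.
- intros k. pose proof (shift_pos x (S k) Hx).
  rewrite Rmult_0_l. now apply Rlt_le, Rinv_0_lt_compat, pow_lt.
- apply (ex_series_scal (V := R_NormedModule) 0).
  now apply (ex_series_incr_1 (fun k => / (x + INR k) ^ m)).
- now apply (ex_series_incr_1 (fun k => / (x + INR k) ^ m)).
Qed.

Lemma hurwitz_pos m x : (2 <= m)%nat -> 0 < x -> 0 < hurwitz m x.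
Proof.
intros Hm Hx. apply Rlt_le_trans with (2 := hurwitz_ge_first_term m x Hm Hx).
now apply Rinv_0_lt_compat, pow_lt.
Qed.

Lemma inv_pow_pinched m k :
  slope_pinched (fun x => / (x + INR k) ^ m)
    (fun x => - INR m * / (x + INR k) ^ S m).
Proof.
apply slope_pinched_of_derive.
- intros x Hx. pose proof (shift_pos x k Hx).
  auto_derive; [apply pow_nonzero; lra|].
  destruct m as [|m]; [simpl; field; lra|].
  assert ((x + INR k) ^ m <> 0) by (apply pow_nonzero; lra).
  simpl pred. rewrite <- !tech_pow_Rmult. field; repeat split; lra.
- intros x y Hx Hxy. pose proof (shift_pos x k Hx).
  pose proof (pos_INR m).
  assert (/ (y + INR k) ^ S m <= / (x + INR k) ^ S m); [|nra].
  apply Rinv_le_contravar; [now apply pow_lt|apply pow_incr; lra].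
Qed.

Lemma hurwitz_pinched m : (2 <= m)%nat ->
  slope_pinched (hurwitz m) (fun x => - INR m * hurwitz (S m) x).
Proof.
intros Hm x y Hx Hxy. unfold hurwitz.
rewrite <- !(Series_scal_l (- INR m)).
refine (slope_pinched_series _ _ (inv_pow_pinched m) _ _ x y Hx Hxy).
- intros z Hz. now apply ex_series_hurwitz.
- intros z Hz. apply (ex_series_scal (V := R_NormedModule) (- INR m)).
  apply ex_series_hurwitz; [lia|assumption].
Qed.

Lemma hurwitz_continuous m x : (2 <= m)%nat -> 0 < x -> continuous (hurwitz m) x.
Proof.
intros Hm Hx. exact (slope_pinched_continuous _ _ x (hurwitz_pinched m Hm) Hx).
Qed.

(** The pinching by exponent S m gives the derivative once exponent S m is known
    to be continuous, which follows from its own pinching by exponent S (S m). *)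
Lemma hurwitz_is_derive m x : (2 <= m)%nat -> 0 < x ->
  is_derive (hurwitz m) x (- INR m * hurwitz (S m) x).
Proof.
intros Hm Hx.
apply (slope_pinched_is_derive _ _ x (hurwitz_pinched m Hm) Hx).
apply (continuous_scal_r (V := R_NormedModule) (- INR m) (hurwitz (S m))).
apply hurwitz_continuous; [lia|assumption].
Qed.

Lemma hurwitz_decr m x y : (2 <= m)%nat -> 0 < x -> x < y ->
  hurwitz m y < hurwitz m x.
Proof.
intros Hm Hx Hxy. destruct (hurwitz_pinched m Hm x y Hx Hxy) as [_ H].
pose proof (hurwitz_pos (S m) y ltac:(lia) ltac:(lra)).
pose proof (lt_0_INR m ltac:(lia)).
assert (0 < (y - x) * (INR m * hurwitz (S m) y))
  by (repeat apply Rmult_lt_0_compat; lra).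
lra.
Qed.

(** Of the 2 + m factors in each term, m are at most 1/x, and the remaining two
    are compared with a telescoping series of sum 1/x. *)
Lemma hurwitz_bound m x : 0 < x -> hurwitz (2 + m) (1 + x) <= / x ^ S m.
Proof.
intros Hx. simpl pow. rewrite Rinv_mult, Rmult_comm.
rewrite <- (is_series_unique _ _ (is_series_telescope x Hx)).
rewrite <- Series_scal_l. unfold hurwitz. apply Series_le_ex.
- intros k. pose proof (shift_pos x k Hx). pose proof (pos_INR k).
  replace (1 + x + INR k) with (x + INR k + 1) by ring.
  replace (x + 1 + INR k) with (x + INR k + 1) by ring.
  rewrite Nat.add_comm, pow_add, Rinv_mult.
  apply Rmult_le_compat.
  + apply Rlt_le, Rinv_0_lt_compat, pow_lt; lra.
  + apply Rlt_le, Rinv_0_lt_compat, pow_lt; lra.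
  + apply Rinv_le_contravar; [now apply pow_lt|apply pow_incr; lra].
  + now apply inv_sqr_le_telescope.
- apply ex_series_hurwitz; [lia|lra].
- apply (ex_series_scal (V := R_NormedModule) (/ x ^ m)).
  eexists. now apply is_series_telescope.
Qed.

(** * The digamma series *)

(** The logarithms are increments of ln (k + 1), so their partial sums are
    ln (n + 2): the opposite of the sum is the limit of
    ln n - sum_(k <= n) 1/(x+k), Gauss's form of the digamma function. *)
Definition digamma_term (k : nat) (x : R) : R :=
  / (x + INR k) - ln ((INR k + 2) / (INR k + 1)).

Definition digamma (x : R) : R := - Series (fun k => digamma_term k x).

Lemma ln_le_pred u : 0 < u -> ln u <= u - 1.
Proof. intros Hu. pose proof (ln_le_linear 1 u Rlt_0_1 Hu) as H. rewrite ln_1 in H. lra. Qed.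

Lemma ln_pinch x y : 0 < x -> 0 < y -> (y - x) / y <= ln y - ln x <= (y - x) / x.
Proof.
intros Hx Hy.
pose proof (ln_le_pred (y / x) ltac:(now apply Rdiv_lt_0_compat)) as H1.
pose proof (ln_le_pred (x / y) ltac:(now apply Rdiv_lt_0_compat)) as H2.
rewrite ln_div in H1, H2 by assumption.
replace ((y - x) / y) with (1 - x / y) by (field; lra).
replace ((y - x) / x) with (y / x - 1) by (field; lra). lra.
Qed.

(** Write the term as (1/(k+1) - ln (1 + 1/(k+1))) + (1/(x+k) - 1/(k+1)).  The
    first bracket is at most 1/(k+1)^2 and the second is a multiple of
    1/((k+1)(x+k)). *)
Lemma digamma_term_ex_series x : 0 < x -> ex_series (fun k => digamma_term k x).
Proof.
intros Hx. set (c := 1 + Rabs (x - 1)).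
apply (ex_series_le (V := R_CompleteNormedModule) _
  (fun k => c * (/ (1 + INR k) ^ 2 + / (x + INR k) ^ 2))).
- intros k. pose proof (shift_pos x k Hx). pose proof (pos_INR k).
  change (Rabs (digamma_term k x) <= c * (/ (1 + INR k) ^ 2 + / (x + INR k) ^ 2)).
  set (a := / (1 + INR k)). set (b := / (x + INR k)).
  assert (Ha : 0 < a) by (apply Rinv_0_lt_compat; lra).
  assert (Hb : 0 < b) by now apply Rinv_0_lt_compat.
  rewrite <- !pow_inv. fold a b.
  assert (Hab : digamma_term k x =
    (a - (ln (INR k + 2) - ln (INR k + 1))) - (x - 1) * (a * b)).
  { unfold digamma_term. rewrite ln_div by lra. unfold a, b. field. lra. }
  assert (Hln : 0 <= a - (ln (INR k + 2) - ln (INR k + 1)) <= a ^ 2).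
  { pose proof (ln_pinch (INR k + 1) (INR k + 2) ltac:(lra) ltac:(lra)) as [H1 H2].
    replace ((INR k + 2 - (INR k + 1)) / (INR k + 1)) with a in H2
      by (unfold a; field; lra).
    split; [lra|].
    apply Rle_trans with (a - (INR k + 2 - (INR k + 1)) / (INR k + 2)); [lra|].
    replace (a - (INR k + 2 - (INR k + 1)) / (INR k + 2))
      with (a * / (INR k + 2)) by (unfold a; field; lra).
    simpl. rewrite Rmult_1_r. apply Rmult_le_compat_l; [lra|].
    apply Rinv_le_contravar; lra. }
  rewrite Hab. apply Rle_trans with (1 := Rabs_triang _ _).
  rewrite Rabs_pos_eq by lra.
  rewrite Rabs_Ropp, Rabs_mult, (Rabs_pos_eq (a * b))
    by (apply Rlt_le; now apply Rmult_lt_0_compat).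
  unfold c. pose proof (Rabs_pos (x - 1)).
  assert (a * b <= a ^ 2 + b ^ 2) by nra.
  assert (Rabs (x - 1) * (a * b) <= Rabs (x - 1) * (a ^ 2 + b ^ 2))
    by (apply Rmult_le_compat_l; lra).
  pose proof (pow2_ge_0 b). lra.
- apply (ex_series_scal (V := R_NormedModule) c).
  apply (ex_series_plus (V := R_NormedModule) (fun k => / (1 + INR k) ^ 2));
    apply ex_series_hurwitz; lia || lra.
Qed.

(** Digamma is concave, so it is its opposite that fits the convex setting of
    [slope_pinched]. *)
Lemma digamma_opp_pinched :
  slope_pinched (fun x => Series (fun k => digamma_term k x))
    (fun x => - hurwitz 2 x).
Proof.
intros x y Hx Hxy. unfold hurwitz. rewrite <- !Series_opp.
refine (slope_pinched_series digamma_term (fun k x => - / (x + INR k) ^ 2) _ _ _ x y Hx Hxy).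
- intros k a b Ha Hab. pose proof (inv_pow_pinched 1 k a b Ha Hab) as H.
  simpl in H |- *. unfold digamma_term. rewrite !Rmult_1_r in *. lra.
- intros z Hz. now apply digamma_term_ex_series.
- intros z Hz. apply (ex_series_opp (V := R_NormedModule)).
  now apply ex_series_hurwitz.
Qed.

Lemma digamma_continuous x : 0 < x -> continuous digamma x.
Proof.
intros Hx. apply (continuous_opp (V := R_NormedModule)).
exact (slope_pinched_continuous _ _ x digamma_opp_pinched Hx).
Qed.

Lemma digamma_is_derive x : 0 < x -> is_derive digamma x (hurwitz 2 x).
Proof.
intros Hx. rewrite <- (Ropp_involutive (hurwitz 2 x)).
apply (is_derive_opp (V := R_NormedModule)).
apply (slope_pinched_is_derive _ _ x digamma_opp_pinched Hx).
apply (continuous_opp (V := R_NormedModule)). now apply hurwitz_continuous.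
Qed.

(** * The slopes of ln Gamma *)

Lemma ln_shift_lim a : 0 < a ->
  is_lim_seq (fun n => ln (a + INR n) - ln (2 + INR n)) 0.
Proof.
intros Ha.
assert (Hlim : forall b, is_lim_seq (fun n => (a - 2) * / (b + INR n)) 0).
{ intros b. replace (Finite 0) with (Rbar_mult (a - 2) 0)
    by (simpl; f_equal; ring).
  apply is_lim_seq_scal_l, is_lim_seq_inv_shift. }
apply (is_lim_seq_le_le _ _ _ _) with (2 := Hlim a) (3 := Hlim 2).
intros n. pose proof (shift_pos a n Ha). pose proof (pos_INR n).
pose proof (ln_pinch (2 + INR n) (a + INR n) ltac:(lra) ltac:(lra)) as H1.
now replace (a + INR n - (2 + INR n)) with (a - 2) in H1 by ring.
Qed.

Lemma lnGamma_increment x n : 0 < x ->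
  lnGamma (x + INR (S n)) = lnGamma (x + INR n) + ln (x + INR n).
Proof.
intros Hx. rewrite S_INR, <- Rplus_assoc. now apply lnGamma_succ, shift_pos.
Qed.

(** By convexity, the slope of ln Gamma between x+n+1 and y+n+1 is at least the
    slope ln (x+n) on the preceding unit interval and at most the slope
    ln (y+n+1) on the following one.  Both differ from ln (n+2) by o(1). *)
Lemma lnGamma_gap_lim x y : 0 < x -> x < y ->
  is_lim_seq (fun n => lnGamma (y + INR (S n)) - lnGamma (x + INR (S n))
    - (y - x) * ln (2 + INR n)) 0.
Proof.
intros Hx Hxy.
assert (Hlim : forall a, 0 < a ->
  is_lim_seq (fun n => (y - x) * (ln (a + INR n) - ln (2 + INR n))) 0).
{ intros a Ha. replace (Finite 0) with (Rbar_mult (y - x) 0)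
    by (simpl; f_equal; ring).
  now apply is_lim_seq_scal_l, ln_shift_lim. }
apply (is_lim_seq_le_le _ _ _ _)
  with (2 := Hlim x Hx) (3 := Hlim (y + 1) ltac:(lra)).
intros n. pose proof (shift_pos x n Hx).
pose proof (lnGamma_increment x n Hx) as Ex.
pose proof (lnGamma_increment y (S n) ltac:(lra)) as Ey.
pose proof (S_INR n) as E1. pose proof (S_INR (S n)) as E2.
pose proof (lnGamma_slopes (x + INR n) (x + INR (S n)) (y + INR (S n))
  ltac:(lra) ltac:(lra) ltac:(lra)) as Hlow.
pose proof (lnGamma_slopes (x + INR (S n)) (y + INR (S n)) (y + INR (S (S n)))
  ltac:(lra) ltac:(lra) ltac:(lra)) as Hup.
rewrite Ex in Hlow. rewrite Ey in Hup.
replace (y + 1 + INR n) with (y + INR (S n)) by lra.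
replace (x + INR (S n) - (x + INR n)) with 1 in Hlow by lra.
replace (y + INR (S (S n)) - (y + INR (S n))) with 1 in Hup by lra.
rewrite Ex.
replace (y + INR (S n) - (x + INR (S n))) with (y - x) in Hup by ring.
replace (y + INR (S n) - (x + INR (S n))) with (y - x) in Hlow by ring.
rewrite Ex in Hup. lra.
Qed.

(** The functional equation, applied n + 1 times, turns the increment at distance
    n + 1 into the one at 0 plus increments ln (y+k) - ln (x+k), each of which lies
    between (y-x)/(y+k) and (y-x)/(x+k). *)
Lemma lnGamma_partial_pinch x y n : 0 < x -> x < y ->
  lnGamma (y + INR (S n)) - lnGamma (x + INR (S n)) - (y - x) * ln (2 + INR n)
    - (y - x) * sum_n (fun k => digamma_term k x) n <= lnGamma y - lnGamma x /\
  lnGamma y - lnGamma x <=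
  lnGamma (y + INR (S n)) - lnGamma (x + INR (S n)) - (y - x) * ln (2 + INR n)
    - (y - x) * sum_n (fun k => digamma_term k y) n.
Proof.
intros Hx Hxy.
assert (Hstep : forall k, (y - x) / (y + INR k) <= ln (y + INR k) - ln (x + INR k)
  <= (y - x) / (x + INR k)).
{ intros k. pose proof (shift_pos x k Hx).
  replace (y - x) with (y + INR k - (x + INR k)) by ring.
  apply ln_pinch; lra. }
induction n as [|n IH].
- pose proof (Hstep 0%nat) as H.
  rewrite !lnGamma_increment, !sum_O by lra. unfold digamma_term.
  simpl INR in *. rewrite !Rplus_0_r, !Rplus_0_l in *. rewrite Rdiv_1_r. lra.
- pose proof (Hstep (S n)) as H. unfold Rdiv in H.
  assert (Hterm : forall z, digamma_term (S n) z =
    / (z + INR (S n)) - (ln (2 + INR (S n)) - ln (2 + INR n))).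
  { intros z. unfold digamma_term. pose proof (pos_INR n).
    rewrite ln_div by (rewrite S_INR; lra).
    replace (INR (S n) + 2) with (2 + INR (S n)) by ring.
    now replace (INR (S n) + 1) with (2 + INR n) by (rewrite S_INR; ring). }
  rewrite (lnGamma_increment y (S n)), (lnGamma_increment x (S n)) by lra.
  rewrite !sum_n_succ, !Hterm. lra.
Qed.

Lemma lnGamma_pinched : slope_pinched lnGamma digamma.
Proof.
intros x y Hx Hxy.
assert (Hlim : forall z, 0 < z -> is_lim_seq (fun n =>
  lnGamma (y + INR (S n)) - lnGamma (x + INR (S n)) - (y - x) * ln (2 + INR n)
    - (y - x) * sum_n (fun k => digamma_term k z) n) ((y - x) * digamma z)).
{ intros z Hz.
  replace ((y - x) * digamma z)
    with (0 - (y - x) * Series (fun k => digamma_term k z)) by (unfold digamma; ring).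
  apply is_lim_seq_minus'; [now apply lnGamma_gap_lim|].
  apply (is_lim_seq_scal_l _ (y - x) (Series (fun k => digamma_term k z))).
  exact (Series_correct _ (digamma_term_ex_series z Hz)). }
split.
- refine (is_lim_seq_le _ _ _ _ _ (Hlim x Hx) (is_lim_seq_const _)).
  intros n. now apply lnGamma_partial_pinch.
- refine (is_lim_seq_le _ _ _ _ _ (is_lim_seq_const _) (Hlim y ltac:(lra))).
  intros n. now apply lnGamma_partial_pinch.
Qed.

(** * Polygamma functions *)

Lemma locally_pos x : 0 < x -> locally x (fun y => 0 < y).
Proof. intros Hx. now apply (open_gt 0). Qed.

(** Gamma is differentiable because ln Gamma is pinched by a continuous
    function. *)
Lemma Gamma_is_derive x : 0 < x -> is_derive Gamma x (digamma x * Gamma x).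
Proof.
intros Hx.
apply (is_derive_ext_loc (fun y => exp (lnGamma y))).
{ apply filter_imp with (2 := locally_pos x Hx). intros y Hy.
  now apply exp_ln, Gamma_pos. }
assert (HG : is_derive lnGamma x (digamma x)).
{ apply (slope_pinched_is_derive _ _ x lnGamma_pinched Hx).
  now apply digamma_continuous. }
replace (Gamma x) with (exp (lnGamma x)) by (now apply exp_ln, Gamma_pos).
apply (is_derive_comp exp lnGamma x _ _ (is_derive_exp _) HG).
Qed.

Lemma psi_digamma x : 0 < x -> psi x = digamma x.
Proof.
intros Hx. unfold psi. rewrite (is_derive_unique _ _ _ (Gamma_is_derive x Hx)).
field. now apply Rgt_not_eq, Gamma_pos.
Qed.

(** The absolute value of the polygamma function of order j + 1; the shift by
    one leaves out psi itself, whose series is of a different kind. *)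
Definition abs_polygamma (j : nat) (x : R) : R :=
  INR (fact (S j)) * hurwitz (S (S j)) x.

Lemma abs_polygamma_is_derive j x : 0 < x ->
  is_derive (abs_polygamma j) x (- abs_polygamma (S j) x).
Proof.
intros Hx.
replace (- abs_polygamma (S j) x)
  with (INR (fact (S j)) * (- INR (S (S j)) * hurwitz (S (S (S j))) x)).
- apply (is_derive_scal (hurwitz (S (S j)))). apply hurwitz_is_derive; [lia|assumption].
- unfold abs_polygamma. rewrite (fact_simpl (S j)), mult_INR. ring.
Qed.

Lemma polygamma_abs j x : 0 < x -> polygamma (S j) x = (-1) ^ j * abs_polygamma j x.
Proof.
unfold polygamma. revert x. induction j as [|j IH]; intros x Hx.
- change (Derive psi x = 1 * (1 * hurwitz 2 x)).
  rewrite (Derive_ext_loc psi digamma).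
  + rewrite (is_derive_unique _ _ _ (digamma_is_derive x Hx)). ring.
  + apply filter_imp with (2 := locally_pos x Hx). exact psi_digamma.
- change (Derive (Derive_n psi (S j)) x = (-1) ^ S j * abs_polygamma (S j) x).
  rewrite (Derive_ext_loc _ (fun y => (-1) ^ j * abs_polygamma j y)).
  + rewrite Derive_scal.
    rewrite (is_derive_unique _ _ _ (abs_polygamma_is_derive j x Hx)).
    simpl. ring.
  + apply filter_imp with (2 := locally_pos x Hx). exact IH.
Qed.

Lemma abs_polygamma_pos j x : 0 < x -> 0 < abs_polygamma j x.
Proof.
intros Hx. apply Rmult_lt_0_compat; [apply INR_fact_lt_0|].
apply hurwitz_pos; [lia|assumption].
Qed.

Lemma abs_polygamma_decr j x y : 0 < x -> x < y ->
  abs_polygamma j y < abs_polygamma j x.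
Proof.
intros Hx Hxy. apply Rmult_lt_compat_l; [apply INR_fact_lt_0|].
apply hurwitz_decr; [lia|assumption|assumption].
Qed.

(** Strict convexity: the graph lies above its tangents because the derivative is
    strictly increasing. *)
Lemma abs_polygamma_tangent j x y : 0 < x -> 0 < y -> x <> y ->
  abs_polygamma j x - (y - x) * abs_polygamma (S j) x < abs_polygamma j y.
Proof.
intros Hx Hy Hne.
assert (HD : forall c, 0 < c ->
  derivable_pt_lim (abs_polygamma j) c (- abs_polygamma (S j) c)).
{ intros c Hc. now apply is_derive_Reals, abs_polygamma_is_derive. }
destruct (Rtotal_order x y) as [Hlt|[Heq|Hgt]]; [|easy|].
- destruct (MVT_cor2 (abs_polygamma j) (fun c => - abs_polygamma (S j) c) x y Hlt)
    as (c & Hc & Hcxy); [intros c Hc; apply HD; lra|].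
  pose proof (abs_polygamma_decr (S j) x c Hx ltac:(lra)). nra.
- destruct (MVT_cor2 (abs_polygamma j) (fun c => - abs_polygamma (S j) c) y x Hgt)
    as (c & Hc & Hcxy); [intros c Hc; apply HD; lra|].
  pose proof (abs_polygamma_decr (S j) c x ltac:(lra) ltac:(lra)). nra.
Qed.

(** * Monotonicity and limits *)

(** The function f_(j+1) without its sign (-1)^j. *)
Definition abs_f (j : nat) (x : R) : R :=
  abs_polygamma j (x + 1) + x * abs_polygamma (S j) (1 + x / 2).

Lemma f_abs j x : -1 < x -> f_ (S j) x = (-1) ^ j * abs_f j x.
Proof.
intros Hx. unfold f_, abs_f. rewrite !polygamma_abs by lra. simpl. ring.
Qed.

Lemma abs_f_is_derive j x : -1 < x ->
  is_derive (abs_f j) x (- abs_polygamma (S j) (x + 1) + abs_polygamma (S j) (1 + x / 2)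
    - x / 2 * abs_polygamma (S (S j)) (1 + x / 2)).
Proof.
intros Hx. unfold abs_f.
pose proof (abs_polygamma_is_derive j (x + 1) ltac:(lra)) as H1.
pose proof (abs_polygamma_is_derive (S j) (1 + x / 2) ltac:(lra)) as H2.
auto_derive.
- repeat split; eexists; eassumption.
- assert (E1 : Derive (fun y : R => abs_polygamma j y) (x + 1) =
    - abs_polygamma (S j) (x + 1)) by now apply is_derive_unique.
  assert (E2 : Derive (fun y : R => abs_polygamma (S j) y) (1 + x / 2) =
    - abs_polygamma (S (S j)) (1 + x / 2)) by now apply is_derive_unique.
  unfold Rdiv in *. rewrite E1, E2. field.
Qed.

(** This is the tangent inequality at 1 + x/2, evaluated at 1 + x; the two points
    coincide exactly when x = 0. *)
Lemma abs_f_derive_neg j x : -1 < x -> x <> 0 ->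
  - abs_polygamma (S j) (x + 1) + abs_polygamma (S j) (1 + x / 2)
    - x / 2 * abs_polygamma (S (S j)) (1 + x / 2) < 0.
Proof.
intros Hx Hx0.
pose proof (abs_polygamma_tangent (S j) (1 + x / 2) (x + 1) ltac:(lra) ltac:(lra)
  ltac:(lra)) as H.
replace (x + 1 - (1 + x / 2)) with (x / 2) in H by field. lra.
Qed.

(** The derivative vanishes at 0, so intervals that contain 0 in their interior
    are split there. *)
Lemma abs_f_decr j x y : -1 < x -> x < y -> abs_f j y < abs_f j x.
Proof.
intros Hx Hxy.
assert (Hside : forall a b, -1 < a -> a < b -> (0 <= a \/ b <= 0) ->
  abs_f j b < abs_f j a).
{ intros a b Ha Hab H0.
  destruct (MVT_cor2 (abs_f j) _ a b Hab (fun c Hc =>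
    proj1 (is_derive_Reals _ _ _) (abs_f_is_derive j c (Rlt_le_trans _ _ _ Ha (proj1 Hc)))))
    as (c & Hc & Hcab).
  pose proof (abs_f_derive_neg j c ltac:(lra) ltac:(lra)). nra. }
destruct (Rle_lt_dec 0 x) as [H|H]; [apply Hside; lra|].
destruct (Rle_lt_dec y 0) as [H'|H']; [apply Hside; lra|].
apply Rlt_trans with (abs_f j 0); apply Hside; lra.
Qed.

Lemma INR_fact_ge_1 n : 1 <= INR (fact n).
Proof. apply (le_INR 1), lt_O_fact. Qed.

(** The first term of the series for [abs_polygamma j (x + 1)] blows up, while
    x times the other polygamma function stays bounded. *)
Lemma abs_f_lower j x : -1 < x < 0 ->
  / (x + 1) - abs_polygamma (S j) (1 / 2) <= abs_f j x.
Proof.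
intros Hx. unfold abs_f.
assert (H1 : / (x + 1) <= abs_polygamma j (x + 1)).
{ apply Rle_trans with (1 * / (x + 1) ^ S (S j)).
  - rewrite Rmult_1_l. apply Rinv_le_contravar; [apply pow_lt; lra|].
    assert ((x + 1) ^ S j <= 1) by (rewrite <- (pow1 (S j)) at 2; apply pow_incr; lra).
    rewrite <- tech_pow_Rmult. nra.
  - apply Rmult_le_compat; [lra| |apply INR_fact_ge_1|].
    + apply Rlt_le, Rinv_0_lt_compat, pow_lt. lra.
    + apply hurwitz_ge_first_term; [lia|lra]. }
pose proof (abs_polygamma_decr (S j) (1 / 2) (1 + x / 2) ltac:(lra) ltac:(lra)).
pose proof (abs_polygamma_pos (S j) (1 + x / 2) ltac:(lra)).
nra.
Qed.

Lemma abs_f_lim_left j : filterlim (abs_f j) (at_right (-1)) (Rbar_locally p_infty).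
Proof.
intros P [M HM].
set (c := abs_polygamma (S j) (1 / 2)).
assert (Hc : 0 < c) by (apply abs_polygamma_pos; lra).
pose proof (Rabs_pos M). pose proof (Rle_abs M).
set (d := / (Rabs M + c + 1)).
assert (Hd : 0 < d) by (apply Rinv_0_lt_compat; lra).
assert (Hd1 : d < 1).
{ rewrite <- Rinv_1. apply Rinv_lt_contravar; lra. }
exists (mkposreal d Hd). intros x Hx Hx1. apply HM.
change (Rabs (x - -1) < d) in Hx. apply Rabs_def2 in Hx.
pose proof (abs_f_lower j x ltac:(lra)) as Hlow. fold c in Hlow.
assert (Rabs M + c + 1 < / (x + 1)); [|lra].
rewrite <- (Rinv_inv (Rabs M + c + 1)). fold d.
apply Rinv_lt_contravar; [apply Rmult_lt_0_compat|]; lra.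
Qed.

Lemma abs_polygamma_bound j k x : (k <= S j)%nat -> 1 <= x ->
  abs_polygamma j (1 + x) <= INR (fact (S j)) * / x ^ k.
Proof.
intros Hk Hx. apply Rmult_le_compat_l; [apply pos_INR|].
apply Rle_trans with (1 := hurwitz_bound j x ltac:(lra)).
apply Rinv_le_contravar; [apply pow_lt; lra|now apply Rle_pow].
Qed.

(** The factor x costs one power, and order j + 2 >= 2 decays at least like
    (x/2)^(-2). *)
Lemma abs_f_upper j x : 2 <= x ->
  0 < abs_f j x <= (INR (fact (S j)) + 4 * INR (fact (S (S j)))) / x.
Proof.
intros Hx. unfold abs_f.
pose proof (abs_polygamma_pos j (x + 1) ltac:(lra)).
pose proof (abs_polygamma_pos (S j) (1 + x / 2) ltac:(lra)).
pose proof (abs_polygamma_bound j 1 x ltac:(lia) ltac:(lra)) as H1.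
pose proof (abs_polygamma_bound (S j) 2 (x / 2) ltac:(lia) ltac:(lra)) as H2.
rewrite Rplus_comm, pow_1 in H1.
apply Rmult_le_compat_l with (r := x) in H2; [|lra].
replace (x * (INR (fact (S (S j))) * / (x / 2) ^ 2))
  with (4 * INR (fact (S (S j))) / x) in H2 by (field; lra).
split; [nra|]. unfold Rdiv in *. lra.
Qed.

Lemma f_lim_infty j : is_lim (f_ (S j)) p_infty 0.
Proof.
set (C := INR (fact (S j)) + 4 * INR (fact (S (S j)))).
intros P [eps HP]. pose proof (cond_pos eps) as Heps.
exists (Rmax 2 (C / eps)). intros x Hx.
pose proof (Rmax_l 2 (C / eps)). pose proof (Rmax_r 2 (C / eps)).
apply HP. change (Rabs (f_ (S j) x - 0) < eps).
rewrite Rminus_0_r, f_abs, Rabs_mult, pow_1_abs, Rmult_1_l by lra.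
pose proof (abs_f_upper j x ltac:(lra)) as Hup. fold C in Hup.
rewrite Rabs_pos_eq by lra. apply Rle_lt_trans with (1 := proj2 Hup).
apply Rcomplements.Rlt_div_l; [lra|].
assert (HC : C / eps < x) by lra.
apply Rcomplements.Rlt_div_l in HC; lra.
Qed.

Lemma pow_m1_even j : Nat.Even j -> (-1) ^ j = 1.
Proof. intros [k ->]. apply pow_1_even. Qed.

Lemma pow_m1_odd j : Nat.Odd j -> (-1) ^ j = -1.
Proof. intros [k ->]. rewrite Nat.add_1_r. apply pow_1_odd. Qed.

Theorem theorem6 :
  forall i : nat, (0 < i)%nat ->
    (Nat.Odd i -> forall x y : R, -1 < x -> x < y -> f_ i y < f_ i x) /\
    (Nat.Even i -> forall x y : R, -1 < x -> x < y -> f_ i x < f_ i y) /\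
    filterlim (f_ i) (at_right (-1))
      (Rbar_locally (if Nat.odd i then p_infty else m_infty)) /\
    is_lim (f_ i) p_infty 0.
Proof.
intros [|j] Hi; [lia|]. clear Hi.
split; [|split; [|split]].
- intros Hodd x y Hx Hxy. apply Nat.Odd_succ in Hodd.
  pose proof (abs_f_decr j x y Hx Hxy).
  rewrite !f_abs, pow_m1_even by (assumption || lra). lra.
- intros Heven x y Hx Hxy. apply Nat.Even_succ in Heven.
  pose proof (abs_f_decr j x y Hx Hxy).
  rewrite !f_abs, pow_m1_odd by (assumption || lra). lra.
- apply (filterlim_ext_loc (fun x => (-1) ^ j * abs_f j x)).
  { exists (mkposreal 1 Rlt_0_1). intros x _ Hx. symmetry. now apply f_abs. }
  rewrite Nat.odd_succ. destruct (Nat.even j) eqn:Hj.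
  + apply Nat.even_spec in Hj. rewrite pow_m1_even by assumption.
    apply (filterlim_ext (abs_f j)); [intros x; ring|apply abs_f_lim_left].
  + assert (Hodd : Nat.Odd j) by (apply Nat.odd_spec; unfold Nat.odd; now rewrite Hj).
    rewrite pow_m1_odd by assumption.
    apply (filterlim_ext (fun x => - abs_f j x)); [intros x; ring|].
    apply filterlim_comp with (1 := abs_f_lim_left j).
    exact (filterlim_Rbar_opp p_infty).
- apply f_lim_infty.
Qed.
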